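(* Let $K\ge 2$, let $(p_{ij})_{i,j\in\Sigma}$ be the transition matrix of an irreducible, aperiodic Markov chain on $\Sigma=\{1,\dots,K\}$, and let $j\ge1$ be an integer. Then $$\lim_{m\to\infty}\frac{1}{\ln(m)}G_{m,j}=C_*\qquad\text{almost surely,}$$ where $C_*=\lim_{\theta\to-\infty}\frac{\rho(\theta)}{-\rho'(\theta)}$.
   Context: Boxes: they are indexed by words $u\in\bigcup_{n\ge0}\Sigma^n$. At generation $0$ there is one box $b_\emptyset$ of size $1$ and type $1$. A box $b_u$ of generation $n$ and type $i$ is split at generation $n+1$ into sub-boxes $b_{uk}$, $k\in\Sigma$, where $b_{uk}$ has type $k$ and size $|b_{uk}|=|b_u|\,p_{ik}$. Only boxes of strictly positive size (corresponding to possible trajectories) are considered. Balls: an infinite sequence of balls is thrown successively and independently; each ball starts in $b_\emptyset$ and, when in a box $b_u$, falls at the next generation into $b_{uk}$ with probability $|b_{uk}|/|b_u|$. $G_{m,j}$ is the first generation at which there exists a box containing strictly less than $j$ balls when the first $m$ balls have been thrown. For $\theta\in\mathbb R$, $A(\theta)=(p_{ij}^{\theta})_{i,j\in\Sigma}$ with the convention $p_{ij}^\theta=0$ if $p_{ij}=0$ (even for $\theta\le0$), and $\rho(\theta)$ is the maximum modulus (Perron–Frobenius) eigenvalue of $A(\theta)$; it is an analytic function of $\theta$ and $\ln\rho$ is convex. *)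

(* Defs.v *)
From HB Require Import structures.
From mathcomp Require Import all_boot all_order all_algebra.
From mathcomp Require Import complex.
From mathcomp Require Import all_classical all_reals all_analysis.

Set Implicit Arguments.
Unset Strict Implicit.
Unset Printing Implicit Defensive.

Import Order.TTheory GRing.Theory Num.Theory.
Import numFieldNormedType.Exports.

Local Open Scope classical_set_scope.
Local Open Scope ring_scope.

Section MarkovChain.
Context {R : realType} {K : nat}.
Implicit Types (p : 'M[R]_K).

Definition stochastic p : Prop :=
  (forall i j, 0 <= p i j) /\ (forall i, \sum_j p i j = 1).

Definition irreducible_chain p : Prop :=
  forall i j, exists n : nat, 0 < (p ^+ n) i j.

(* The gcd of the return times to i is 1: their only common divisor is 1. *)
Definition aperiodic_chain p : Prop :=
  forall (i : 'I_K) (d : nat),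
    (forall n : nat, (0 < n)%N -> 0 < (p ^+ n) i i -> (d %| n)%N) -> d = 1%N.

(* The test on p i j is needed at theta = 0, where 0 `^ 0 = 1. *)
Definition mx_powR p (theta : R) : 'M[R]_K :=
  \matrix_(i, j) (if p i j == 0 then 0 else p i j `^ theta).

(* The comparison of moduli takes place in R[i], whose norm is R[i]-valued. *)
Definition max_modulus_eigenvalue (A : 'M[R]_K) (r : R) : Prop :=
  eigenvalue A r /\
  forall z : R[i], eigenvalue (map_mx (real_complex R) A) z ->
    `|z| <= real_complex R r.

(* There is at most one such r; for p irreducible the Perron-Frobenius theorem
   says there is one, so the default value 0 is not reached. *)
Definition rho p (theta : R) : R :=
  xget 0 [set r | max_modulus_eigenvalue (mx_powR p theta) r].

Definition Cstar_ratio p (theta : R) : R :=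
  rho p theta / - derive1 (rho p) theta.

Definition Cstar p : R := lim (Cstar_ratio p theta @[theta --> -oo]).

End MarkovChain.

Section Boxes.
Context {R : realType} {K : nat}.
Variables (p : 'M[R]_K) (i0 : 'I_K).

(* The pair (type, size) of the box b_u, where i0 is the type of the box of
   generation 0. *)
Definition box (u : seq 'I_K) : 'I_K * R :=
  foldl (fun b k => (k, b.2 * p b.1 k)) (i0, 1) u.

Definition box_size (u : seq 'I_K) : R := (box u).2.

End Boxes.

(* X r l w is the last letter of the box of generation l.+1 that contains
   the ball number r. *)
Section Balls.
Context {R : realType} {K : nat} {d : measure_display} {T : measurableType d}.
Variables (p : 'M[R]_K) (i0 : 'I_K) (P : probability T R).
Variable X : nat -> nat -> T -> 'I_K.

Definition ball_box (r n : nat) (w : T) : seq 'I_K :=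
  mkseq (fun l => X r l w) n.

Definition ball_in (r : nat) (u : seq 'I_K) : set T :=
  [set w | ball_box r (size u) w = u].

Definition ball_sigma (r : nat) : set (set T) := <<s range (ball_in r) >>.

Definition balls_independent : Prop :=
  forall (I : seq nat) (E : nat -> set T), uniq I ->
    (forall r, r \in I -> ball_sigma r (E r)) ->
    P (\bigcap_(r in [set` I]) E r) = (\prod_(r <- I) P (E r))%E.

Record balls_process : Prop := BallsProcess {
  balls_measurable : forall r u, measurable (ball_in r u);
  (* the conditional probability of falling into b_{uk} from b_u, multiplied
     out *)
  balls_fall : forall r u k, 0 < box_size p i0 u ->
    P (ball_in r (rcons u k)) =
      (P (ball_in r u) *
       (box_size p i0 (rcons u k) / box_size p i0 u)%:E)%E;
  balls_indep : balls_independent }.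

Definition nb_balls (m : nat) (u : seq 'I_K) (w : T) : nat :=
  #|[pred r : 'I_m | ball_box r (size u) w == u]|.

Definition deficient_generation (m j : nat) (w : T) (n : nat) : Prop :=
  exists u : seq 'I_K,
    [/\ size u = n, 0 < box_size p i0 u & (nb_balls m u w < j)%N].

(* For 1 < K and p stochastic, irreducible and aperiodic, the number of boxes
   is unbounded as the generation grows, so a first deficient generation
   exists if 0 < j, and the default value 0 is not reached. *)
Definition first_deficient (m j : nat) (w : T) : nat :=
  xget 0%N [set n | deficient_generation m j w n /\
    forall n', deficient_generation m j w n' -> (n <= n')%N].

End Balls.

(* Main.v *)
(** Write A for mx_powR p theta, with Perron eigenvectors l, r > 0 normalised by
    l r = 1, and f = ln rho.  Pairing l at theta with r at theta + h gives
    rho' = l A' r, hence - rho' / rho is the mean s(theta) of - ln p_ij under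
      the
    edge weights l_i A_ij r_j / rho, which form a circulation.  Since
    A_ij r_j <= rho r_i, at any theta' < 0 one has on every edge
    - ln p_ij <= f(theta') / (- theta') + a potential difference, so
    s(theta) <= f(theta') / (- theta'); Gibbs' inequality against p gives
    f(theta) <= (1 - theta) s(theta).  So with la := inf f(theta) / (- theta),
    s --> la and Cstar = 1 / la.  The same two edge inequalities, followed along
    a word, show that the smallest positive box of generation n has size
    exp (- la n + o(n)).

    With m balls a box of size much larger than 1 / m is full and one of size
    much smaller than 1 / m is empty, so G_{m,j} ~ ln m / la: this is made
    almost sure by the Borel-Cantelli lemma along m = 2^k and by monotonicity
    in m. *)

Require Import Defs.
From HB Require Import structures.
From mathcomp Require Import all_boot all_order all_algebra.
From mathcomp Require Import complex ring lra zify.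
From mathcomp Require Import all_classical all_reals all_analysis.

Set Implicit Arguments.
Unset Strict Implicit.
Unset Printing Implicit Defensive.

Import Order.TTheory GRing.Theory Num.Theory.
Import numFieldNormedType.Exports.

Local Open Scope classical_set_scope.
Local Open Scope ring_scope.

(** * Perron eigenvectors *)

Lemma finite_positive_lb (R : realFieldType) (I : finType) (F : I -> R) :
  (forall i, 0 < F i) -> exists2 e, 0 < e & forall i, e <= F i.
Proof.
move=> F0; exists (\big[Num.min/1]_i F i); last by move=> i;
  exact: bigmin_le_cond.
by apply/bigmin_gtP; split.
Qed.

Section Perron.
Context {R : realType} {K : nat}.
Implicit Types (A B : 'M[R]_K) (x : 'rV[R]_K).

Definition mx_nonneg m n (M : 'M[R]_(m, n)) := forall i j, 0 <= M i j.
Definition mx_pos m n (M : 'M[R]_(m, n)) := forall i j, 0 < M i j.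

Lemma mulmx_nonneg m n q (M : 'M[R]_(m, n)) (N : 'M[R]_(n, q)) :
  mx_nonneg M -> mx_nonneg N -> mx_nonneg (M *m N).
Proof. by move=> hM hN i j; rewrite mxE sumr_ge0 // => k _;
  rewrite mulr_ge0. Qed.

Lemma mulmx_row_pos x B : mx_nonneg x -> x != 0 -> mx_pos B -> mx_pos (x *m B).
Proof.
move=> x0 xn0 B0 i j; rewrite mxE.
have [k xk] : exists k, x i k != 0.
  apply/existsP; apply: contra_neqT xn0; rewrite negb_exists => /forallP h.
  apply/matrixP => a b; rewrite !mxE; apply/eqP.
  by have := h b; rewrite negbK (ord1 i) (ord1 a).
rewrite (bigD1 k) //= ltr_pwDl //; first by rewrite mulr_gt0 // lt_def xk x0.
by apply: sumr_ge0 => l _; rewrite mulr_ge0 // ltW.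
Qed.

Lemma eigen_row_sum_exp A x t N : x *m A = t *: x ->
  x *m (\sum_(n < N) A ^+ n) = (\sum_(n < N) t ^+ n) *: x.
Proof.
move=> xA; rewrite mulmx_sumr scaler_suml; apply: eq_bigr => n _.
elim: (n : nat) => [|k ih]; first by rewrite expr0 mulmx1 expr0 scale1r.
by rewrite exprSr -mulmxE mulmxA ih -scalemxAl xA scalerA exprSr.
Qed.

Lemma continuous_fun_sum (T : topologicalType) n (F : 'I_n -> T -> R) :
  (forall i, continuous (F i)) -> continuous (fun z => \sum_i F i z).
Proof.
move=> cF z; apply: (@cvg_big R _ +%R 0 xpredT _ T (nbhs z) _ F (F^~ z)).
  exact: (@add_continuous R).
by move=> i _; exact: cF.
Qed.

Lemma closed_ge0_preimage (T : topologicalType) (g : T -> R) : continuous g ->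
  closed [set z | 0 <= g z].
Proof.
by move=> /continuous_closedP /(_ [set x | 0 <= x]); apply; exact: closed_ge.
Qed.

(** The total of [x] is only bounded below: together with the unit cube this keeps [x] away from 0,
    and every non-box constraint takes the closed form [0 <= g]. *)
Let subinvariant A (M : R) : set ('rV[R]_K * R) :=
  [set v : 'rV[R]_K | forall i, [set` `[0, 1]%R] (v ord0 i)]
    `*` [set` `[0, M]%R] `&`
  ([set z : 'rV[R]_K * R | 0 <= \sum_j z.1 ord0 j - 1] `&`
   (\bigcap_j [set z : 'rV[R]_K * R |
      0 <= \sum_i z.1 ord0 i * A i j - z.2 * z.1 ord0 j])).

Let subinvariant_compact A M : compact (subinvariant A M).
Proof.
have cc j : continuous (fun z : 'rV[R]_K * R => z.1 ord0 j).
  move=> z; apply: (@cvg_comp _ _ _ fst (fun v : 'rV_K => v ord0 j)).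
    exact: cvg_fst.
  exact: coord_continuous.
apply: compact_closedI.
  apply: compact_setX; last exact: segment_compact.
  have := @rV_compact R K (fun=> [set` `[0, 1]%R])
    (fun=> @segment_compact R 0 1).
  exact.
apply: closedI.
  apply: closed_ge0_preimage => z; apply: cvgB; last exact: cvg_cst.
  exact: continuous_fun_sum.
apply: closed_bigI => j _; apply: closed_ge0_preimage => z; apply: cvgB.
  apply: continuous_fun_sum => i y; apply: cvgM; [exact: cc|exact: cvg_cst].
apply: cvgM; [exact: cvg_snd|exact: cc].
Qed.

(* Maximise [t] over the [x >= 0], bounded away from 0 and infinity, with
   [t x <= x A].  At a maximiser [x A = t x], for otherwise multiplying the gap
   [x A - t x] by the positive matrix [\sum_(n < N) A ^+ n], which commutes with
   [A], makes it strict in every entry, leaving room for a larger [t]. *)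
Lemma perron_row A N : (0 < K)%N -> mx_nonneg A ->
  mx_pos (\sum_(n < N) A ^+ n) ->
  exists t x, [/\ 0 <= t, mx_pos x & x *m A = t *: x].
Proof.
move=> K0 A0; set B := \sum_(n < N) A ^+ n => B0.
have BA : B *m A = A *m B.
  by rewrite mulmx_suml mulmx_sumr; apply: eq_bigr => n _;
    rewrite mulmxE -exprS -exprSr.
(* Summing [t x <= x A] over the entries, with total 1 and [x <= 1], gives [t <= M]; this bound
   makes the search region compact. *)
pose M := \sum_j \sum_i A i j.
pose W := subinvariant A M.
have WP x t : mx_nonneg x -> \sum_j x ord0 j = 1 -> 0 <= t ->
    (forall j, t * x ord0 j <= (x *m A) ord0 j) -> W (x, t).
  move=> x0 x1 t0 tx.
  have xle1 i : x ord0 i <= 1.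
    by rewrite -x1 (bigD1 i) //= lerDl sumr_ge0.
  split; first split => /=.
  - by move=> i; rewrite in_itv /= x0 xle1.
  - rewrite in_itv /= t0 /= -(mulr1 t) -x1 mulr_sumr ler_sum // => j _.
    rewrite (le_trans (tx j)) // mxE ler_sum // => i _.
    by rewrite ler_piMl.
  - split => /=; first by rewrite x1 subrr.
    by move=> j _ /=; have := tx j; rewrite mxE subr_ge0.
have [[x t] /set_mem /= Wx xmax] :
  exists2 z, z \in W & forall y, y \in W -> y.2 <= z.2.
  apply: compact_EVT_max.
  - exists (delta_mx 0 (Ordinal K0), 0); apply: WP => //.
    + by move=> i j; rewrite mxE ler0n.
    + rewrite (bigD1 (Ordinal K0)) //= mxE !eqxx big1 ?addr0 // => j jn.
      by rewrite mxE (negbTE jn).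
    + move=> j; rewrite mul0r; apply: mulmx_nonneg => // a b.
      by rewrite mxE ler0n.
  - exact: subinvariant_compact.
  - by apply: continuous_subspaceT => z; exact: cvg_snd.
case: Wx => -[/= xi]; rewrite in_itv /= => /andP[t0 _] [x1 xt].
have x0 : mx_nonneg x.
  by move=> a i; rewrite (ord1 a); have := xi i; rewrite in_itv /= => /andP[].
have xn0 : x != 0.
  apply: contraTneq x1 => ->; rewrite big1 => [|j _]; last by rewrite mxE.
  by rewrite sub0r oppr_ge0 ler10.
pose dx := x *m A - t *: x.
have dx0 : mx_nonneg dx.
  by move=> a j; rewrite (ord1 a) !mxE; exact: (xt j I).
have y0 : mx_pos (x *m B) by exact: mulmx_row_pos.
have [dx_eq0|dxn0] := eqVneq dx 0.
  have xA : x *m A = t *: x by apply/eqP; rewrite -subr_eq0 -/dx dx_eq0.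
  (* Here [x B] is the multiple [\sum_(n < N) t ^+ n] of [x], so positivity of [x B] excludes zero
     entries of [x]. *)
  exists t, x; split => // i j.
  have := y0 i j; rewrite (eigen_row_sum_exp N xA) mxE.
  rewrite lt0r mulf_eq0 negb_or => /andP[/andP[_ xn] _].
  by rewrite lt0r xn x0.
have dB0 : mx_pos (dx *m B) by exact: mulmx_row_pos.
have [e e0 eP] := finite_positive_lb (dB0 ord0).
pose y := x *m B; pose s := \sum_j y ord0 j.
have s0 : 0 < s.
  by rewrite /s (bigD1 (Ordinal K0)) //= ltr_pwDl // sumr_ge0 // => j _;
    exact: ltW.
have yA j : (y *m A) ord0 j = t * y ord0 j + (dx *m B) ord0 j.
  have -> : y *m A = t *: y + dx *m B.
    by rewrite /dx mulmxBl -scalemxAl -[x *m A *m B]mulmxA -BA mulmxA addrC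
      subrK.
  by rewrite mxE [X in X + _]mxE.
(* Each entry of [y] is at most its total [s], so raising [t] by [e / s] costs at most [e] per entry
   before normalisation, which the gap [dx *m B] pays for. *)
have : W (s^-1 *: y, t + e / s).
  apply: WP.
  - by move=> a j; rewrite mxE mulr_ge0 // ?invr_ge0 ?ltW.
  - rewrite -(mulVf (lt0r_neq0 s0)) mulr_sumr; apply: eq_bigr => j _.
    by rewrite mxE.
  - by rewrite addr_ge0 // divr_ge0 // ltW.
  - move=> j; rewrite -scalemxAl [in leRHS]mxE mxE yA mulrCA.
    rewrite ler_pM2l ?invr_gt0 //.
    rewrite mulrDl lerD2l (le_trans _ (eP j)) // -mulrA ler_piMr ?(ltW e0) //.
    rewrite mulrC ler_pdivrMr // mul1r /s (bigD1 j) //= lerDl sumr_ge0 // => k _.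
    exact: ltW.
move=> /mem_set /xmax /=; by rewrite gerDl leNgt divr_gt0.
Qed.

End Perron.

(** * Perron pairs and the eigenvalue of maximum modulus *)

Section PerronPair.
Context {R : realType} {K : nat}.
Implicit Types (A : 'M[R]_K).

Record perron A (t : R) (l r : 'I_K -> R) : Prop := Perron {
  perron_left_gt0 : forall i, 0 < l i;
  perron_right_gt0 : forall i, 0 < r i;
  perron_left : forall j, \sum_i l i * A i j = t * l j;
  perron_right : forall i, \sum_j A i j * r j = t * r i;
  perron_dot : \sum_i l i * r i = 1 }.

Lemma trmx_exp A n : (A ^+ n)^T = A^T ^+ n.
Proof.
elim: n => [|n ih]; first by rewrite !expr0 trmx1.
by rewrite exprS -mulmxE trmx_mul ih mulmxE -exprSr.
Qed.

Lemma sum_pos_gt0 (F : 'I_K -> R) : (0 < K)%N -> (forall i, 0 < F i) ->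
  0 < \sum_i F i.
Proof.
move=> K0 F0; rewrite (bigD1 (Ordinal K0)) //= ltr_pwDl // sumr_ge0 // => i _.
exact: ltW.
Qed.

(** Evaluating [l A r] from the left and from the right gives [t] and [t'] times the same nonzero
    scalar [l r]. *)
Lemma left_right_eigen_eq A t t' (l r : 'I_K -> R) :
  0 < \sum_i l i * r i ->
  (forall j, \sum_i l i * A i j = t * l j) ->
  (forall i, \sum_j A i j * r j = t' * r i) -> t = t'.
Proof.
move=> lr0 lA Ar; apply: (mulIf (lt0r_neq0 lr0)); rewrite !mulr_sumr.
transitivity (\sum_j (\sum_i l i * A i j) * r j).
  by apply: eq_bigr => j _; rewrite lA mulrA.
under eq_bigr do rewrite mulr_suml.
rewrite exchange_big /=; apply: eq_bigr => i _.
under eq_bigr do rewrite -mulrA.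
by rewrite -mulr_sumr Ar mulrCA.
Qed.

Lemma perron_exists A N : (0 < K)%N -> mx_nonneg A ->
  mx_pos (\sum_(n < N) A ^+ n) ->
  exists t l r, perron A t l r.
Proof.
move=> K0 A0 B0.
have [t [x [t0 x0 xA]]] := perron_row K0 A0 B0.
have [t' [y [t'0 y0 yA]]] : exists t (x :
  'rV[R]_K), [/\ 0 <= t, mx_pos x & x *m A^T = t *: x].
  apply: (@perron_row _ _ _ N) => //; first by move=> i j; rewrite mxE.
  move=> i j; have := B0 j i; rewrite !summxE.
  by congr (0 < _); apply: eq_bigr => n _; rewrite -trmx_exp mxE.
pose l i := x ord0 i.
have lA j : \sum_i l i * A i j = t * l j.
  by have := congr1 (fun v : 'rV_K => v ord0 j) xA; rewrite !mxE.
have Ay i : \sum_j A i j * y ord0 j = t' * y ord0 i.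
  have := congr1 (fun v : 'rV_K => v ord0 i) yA; rewrite !mxE => <-.
  by apply: eq_bigr => j _; rewrite mxE mulrC.
have s0 : 0 < \sum_i l i * y ord0 i by apply: sum_pos_gt0 => // i;
  apply: mulr_gt0; [exact: x0|exact: y0].
have tt' := left_right_eigen_eq s0 lA Ay.
exists t, l, (fun i => y ord0 i / \sum_i l i * y ord0 i); split => //.
- by move=> i; exact: x0.
- by move=> i; rewrite divr_gt0 //; exact: y0.
- move=> i; rewrite tt' mulrA -Ay mulr_suml; apply: eq_bigr => j _.
  by rewrite mulrA.
- by under eq_bigr do rewrite mulrA; rewrite -mulr_suml divff // gt_eqF.
Qed.

(** For a complex left eigenvector [v], the triangle inequality gives [|z| |v| <= |v| A] entrywise;
    pairing with the positive [r] turns this into [|z| <= t]. *)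
Lemma perron_max_modulus A t l r : mx_nonneg A -> perron A t l r ->
  max_modulus_eigenvalue A t.
Proof.
move=> A0 [l0 r0 lA Ar lr1]; split.
  apply/eigenvalueP; exists (\row_i l i).
    apply/rowP => j; rewrite !mxE -lA; apply: eq_bigr => i _.
    by rewrite mxE.
  apply/negP => /eqP /rowP h; move: lr1; rewrite big1 => [/eqP|i _].
    by rewrite eq_sym oner_eq0.
  by have := h i; rewrite !mxE => ->; rewrite mul0r.
move=> z /eigenvalueP[v vA vn0].
pose C := real_complex R.
have Cge0 x : 0 <= x -> 0 <= C x by move=> x0; rewrite (_ : 0 = C 0) // lecR.
have s0 : 0 < \sum_i `|v ord0 i| * C (r i).
  rewrite lt_def sumr_ge0 ?andbT => [|i _];
    last by rewrite mulr_ge0 // Cge0 // ltW.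
  rewrite psumr_eq0 => [|i _]; last by rewrite mulr_ge0 // Cge0 // ltW.
  apply: contra vn0 => /allP h; apply/eqP/rowP => i; rewrite mxE.
  have := h i (mem_index_enum _); rewrite mulf_eq0 normr_eq0 => /orP[/eqP //|].
  by rewrite (_ : 0 = C 0) // => /eqP /complexI /eqP; rewrite gt_eqF.
rewrite -(ler_pM2r s0) !mulr_sumr.
apply: (@le_trans _ _ (\sum_j (\sum_i `|v ord0 i| * C (A i j)) * C (r j))).
  apply: ler_sum => j _; rewrite mulrA ler_wpM2r //;
    first by rewrite Cge0 // ltW.
  have := congr1 (fun v : 'rV_K => v ord0 j) vA; rewrite !mxE -normrM => <-.
  rewrite (le_trans (ler_norm_sum _ _ _)) // ler_sum // => i _.
  by rewrite normrM mxE [X in _ * X]ger0_norm // Cge0.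
under eq_bigr do rewrite mulr_suml.
rewrite exchange_big /= le_eqVlt; apply/orP; left; apply/eqP.
apply: eq_bigr => i _; under eq_bigr do rewrite -mulrA -rmorphM.
by rewrite -mulr_sumr -rmorph_sum Ar rmorphM mulrCA.
Qed.

Lemma max_modulus_eigenvalue_norm A t t' : max_modulus_eigenvalue A t ->
  eigenvalue A t' -> `|t'| <= t.
Proof.
move=> [_ h] /eigenvalueP[v vA vn0].
have : `|real_complex R t'| <= real_complex R t.
  apply: h; apply/eigenvalueP; exists (map_mx (real_complex R) v).
    by rewrite -map_mxM vA map_mxZ.
  by rewrite map_mx_eq0.
by rewrite normc_def /= expr0n /= addr0 sqrtr_sqr lecR.
Qed.

(** Two eigenvalues of maximum modulus bound each other, so the choice made by [xget] can only be
    [t]. *)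
Lemma rho_perron p theta t l r : mx_nonneg (mx_powR p theta) ->
  perron (mx_powR p theta) t l r -> rho p theta = t.
Proof.
move=> A0 /(perron_max_modulus A0) ht; rewrite /rho.
case: xgetP => [t' _ ht'|/(_ t) //]; apply/le_anti/andP; split.
  exact: le_trans (ler_norm _) (max_modulus_eigenvalue_norm ht ht'.1).
exact: le_trans (ler_norm _) (max_modulus_eigenvalue_norm ht' ht.1).
Qed.

End PerronPair.

(** * Differentiability of the Perron eigenvalue *)

Section Perturbation.
Context {R : realType} {K : nat}.
Implicit Types (A : 'M[R]_K).

Lemma exp_subinvariant A c (x : 'cV[R]_K) n : mx_nonneg A -> 0 <= c ->
  (forall i, (A *m x) i ord0 <= c * x i ord0) ->
  forall i, (A ^+ n *m x) i ord0 <= c ^+ n * x i ord0.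
Proof.
move=> A0 c0 Ax; elim: n => [|n ih] i; first by rewrite !expr0 mul1mx mul1r.
rewrite !exprS -mulmxE -mulmxA mxE.
apply: (@le_trans _ _ (\sum_k A i k * (c ^+ n * x k ord0))).
  by apply: ler_sum => k _; rewrite ler_wpM2l.
under eq_bigr do rewrite mulrCA.
rewrite -mulr_sumr [c * _]mulrC -mulrA ler_wpM2l ?exprn_ge0 //.
by have := Ax i; rewrite mxE.
Qed.

Lemma exp_invariant A c (x : 'cV[R]_K) n : A *m x = c *: x ->
  A ^+ n *m x = c ^+ n *: x.
Proof.
move=> Ax; elim: n => [|n ih]; first by rewrite !expr0 mul1mx scale1r.
by rewrite exprS -mulmxE -mulmxA ih -scalemxAr Ax scalerA exprSr.
Qed.

(* With [a := min_i x_i / r_i] and [B := \sum_(n < N) A ^+ n], the vector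
   [x - a r] is nonnegative with a zero entry, where [B (x - a r)] is therefore
   both small and at least a multiple of each entry of [x - a r]. *)
Lemma perron_right_stable A N t l r : (0 < K)%N -> mx_nonneg A -> 0 <= t ->
  mx_pos (\sum_(n < N) A ^+ n) -> perron A t l r ->
  exists C, forall k (x : 'I_K -> R), 1 <= k -> (forall i, 0 < x i) ->
    \sum_i l i * x i = 1 ->
    (forall i, \sum_j A i j * x j <= k * t * x i) ->
    forall i, `|x i - r i| <= C * (k ^+ N - 1).
Proof.
move=> K0 A0 t0; set B := \sum_(n < N) A ^+ n => B0 [l0 r0 lA Ar lr1].
have [b b0 bP] := @finite_positive_lb _ _ (fun ij : 'I_K * 'I_K => B ij.1 ij.2)
  (fun ij => B0 ij.1 ij.2).
pose be := \sum_(n < N) t ^+ n.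
have be0 : 0 <= be by apply: sumr_ge0 => n _; rewrite exprn_ge0.
pose L := \sum_i l i; pose Q := \sum_i r i.
have rQ i : r i <= Q by rewrite /Q (bigD1 i) //= lerDl sumr_ge0 // => k _;
  exact: ltW.
have Q0 : 0 < Q by exact: sum_pos_gt0.
have L0 : 0 < L by exact: sum_pos_gt0.
exists (be * Q / b * (1 + L * Q)) => k x k1 x0 lx1 Ax i.
pose i1 := [arg min_(i < Ordinal K0) (x i / r i)]%O.
pose a := x i1 / r i1.
have aP j : a * r j <= x j.
  rewrite -ler_pdivlMr // /a /i1; case: arg_minP => // i2 _; exact.
have ar1 : a * r i1 = x i1 by rewrite /a divfK // gt_eqF.
have a0 : 0 < a by rewrite divr_gt0.
have a1 : a <= 1.
  rewrite -(mulr1 a) -{1}lr1 -lx1 mulr_sumr ler_sum // => j _.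
  by rewrite mulrCA ler_pM2l.
have kN : 1 <= k ^+ N by exact: exprn_ege1.
pose D := be * Q / b * (k ^+ N - 1).
have D0 : 0 <= D by rewrite mulr_ge0 ?subr_ge0 // divr_ge0 ?mulr_ge0 // ltW.
have BX : (B *m \col_i x i) i1 ord0 <= k ^+ N * be * x i1.
  rewrite mulmx_suml summxE -mulrA mulrCA mulr_suml ler_sum // => n _.
  apply: le_trans (exp_subinvariant n A0 (_ : 0 <= k * t) _ i1) _.
  - by rewrite mulr_ge0 // (le_trans ler01).
  - move=> j; rewrite !mxE (le_trans _ (Ax j)) // le_eqVlt; apply/orP; left.
    by apply/eqP/eq_bigr => m _; rewrite mxE.
  - rewrite mxE exprMn -mulrA [leLHS]mulrCA ler_wpM2l ?exprn_ge0 //.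
    by rewrite ler_wpM2r ?(ltW (x0 _)) // ler_weXn2l // ltnW.
have Br : (B *m \col_i r i) i1 ord0 = be * r i1.
  rewrite mulmx_suml summxE mulr_suml; apply: eq_bigr => n _.
  rewrite (@exp_invariant _ t); first by rewrite !mxE.
  apply/colP => j; rewrite !mxE -Ar; apply: eq_bigr => m _; by rewrite mxE.
have xD j : x j - a * r j <= D.
  rewrite /D [leRHS]mulrAC ler_pdivlMr // [leLHS]mulrC.
  apply: (@le_trans _ _ (\sum_j B i1 j * (x j - a * r j))).
    rewrite (bigD1 j) //= -[leLHS]addr0 lerD //.
      by rewrite ler_wpM2r ?subr_ge0 // (bP (i1, j)).
    by apply: sumr_ge0 => m _; rewrite mulr_ge0 ?subr_ge0 // ltW.
  have -> : \sum_j B i1 j * (x j - a * r j) =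
      (B *m \col_i x i) i1 ord0 - a * (B *m \col_i r i) i1 ord0.
    rewrite !mxE mulr_sumr -sumrB; apply: eq_bigr => m _; rewrite !mxE; ring.
  rewrite Br mulrCA ar1 (le_trans (lerB BX (lexx _))) //.
  rewrite (_ : _ - _ = be * x i1 * (k ^+ N - 1)); last ring.
  rewrite ler_wpM2r ?subr_ge0 // ler_wpM2l // -ar1.
  by rewrite (le_trans _ (rQ i1)) // ler_piMl // ltW.
(* Since [l x = l r = 1], the number [1 - a] is the pairing of [l] with [x - a r], whose entries are
   at most [D]. *)
have a1D : 1 - a <= L * D.
  rewrite -(mulr1 a) -{2}lr1 -lx1 mulr_sumr -sumrB mulr_suml ler_sum // => j _.
  by rewrite mulrCA -mulrBr ler_pM2l.
have -> : be * Q / b * (1 + L * Q) * (k ^+ N - 1) = D + L * D * Q.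
  by rewrite /D; ring.
have h1 : (1 - a) * r i <= L * D * Q.
  by rewrite ler_pM // ?subr_ge0 // ltW.
have h2 := xD i; have h3 := aP i.
have h4 : 0 <= L * D * Q by apply: mulr_ge0; [apply: mulr_ge0 => //|];
  exact: ltW.
have h5 : a * r i <= r i by rewrite ler_piMl // ltW.
by rewrite ler_norml; apply/andP; split; lra.
Qed.

End Perturbation.

(** * The Perron eigenvalue of [mx_powR p theta] as a function of [theta] *)

Section PerronFamily.
Context {R : realType} {K : nat}.

(** Pair the left eigenvector of [A] with the right eigenvector of [A']: [t' (l r') = l A' r' <= k l
    A r' = k t (l r')]. *)
Lemma perron_eigenvalue_le (A A' : 'M[R]_K) t t' l l' r r' k :
  (0 < K)%N -> perron A t l r -> perron A' t' l' r' ->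
  (forall i j, A' i j <= k * A i j) -> t' <= k * t.
Proof.
move=> K0 [l0 r0 lA Ar lr1] [l'0 r'0 lA' Ar' lr1'] AA'.
have s0 : 0 < \sum_i l i * r' i by apply: sum_pos_gt0 => // i; rewrite mulr_gt0.
rewrite -(ler_pM2r s0) mulr_sumr.
apply: (@le_trans _ _ (\sum_i \sum_j l i * (k * A i j) * r' j)).
  apply: ler_sum => i _; rewrite mulrCA -Ar' mulr_sumr ler_sum // => j _.
  by rewrite -[leRHS]mulrA ler_pM2l // ler_pM2r.
rewrite exchange_big /= -mulrA mulr_sumr mulr_sumr ler_sum // => j _.
rewrite [t * _]mulrA -lA -mulr_suml [leRHS]mulrA mulr_sumr.
rewrite le_eqVlt; apply/orP; left; apply/eqP; congr (_ * _).
by apply: eq_bigr => i _; rewrite mulrCA.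
Qed.

Variable p : 'M[R]_K.
Hypotheses (K0 : (0 < K)%N) (p_stoch : stochastic p) (p_irr :
  irreducible_chain p).
Local Notation A := (mx_powR p).

Lemma stochastic_gt0 i j : p i j != 0 -> 0 < p i j.
Proof. by move=> pn; rewrite lt_def pn (p_stoch.1). Qed.

Lemma stochastic_le1 i j : p i j <= 1.
Proof. by rewrite -(p_stoch.2 i) (bigD1 j) //= lerDl sumr_ge0 // => k _;
  exact: p_stoch.1. Qed.

Lemma stochastic_next i : exists j, 0 < p i j.
Proof.
apply/existsP; apply: contraT; rewrite negb_exists => /forallP h.
have := p_stoch.2 i; rewrite big1 => [/eqP|j _];
  first by rewrite eq_sym oner_eq0.
by apply/eqP; apply: contraT => /stochastic_gt0; rewrite (negbTE (h j)).
Qed.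

Lemma mx_powR_expR theta i j :
  0 < p i j -> A theta i j = expR (theta * ln (p i j)).
Proof. by move=> pij; rewrite mxE gt_eqF // /powR gt_eqF. Qed.

Lemma mx_powR_gt0 theta i j : 0 < p i j -> 0 < A theta i j.
Proof. by move=> pij; rewrite mx_powR_expR // expR_gt0. Qed.

Lemma mx_powR_nonneg theta : mx_nonneg (A theta).
Proof. by move=> i j; rewrite mxE; case: ifP => // _; exact: powR_ge0. Qed.

(** Positivity of an entry of a power depends only on which entries of the matrix vanish, and
    [mx_powR p theta] has the zeros of [p]. *)
Lemma mx_powR_exp_gt0 theta n i j : 0 < (p ^+ n) i j -> 0 < (A theta ^+ n) i j.
Proof.
have A0 := mx_powR_nonneg theta.
have An0 (M : 'M[R]_K) m : mx_nonneg M -> mx_nonneg (M ^+ m).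
  move=> M0; elim: m => [|m ih]; first by move=> a b; rewrite expr0 mxE ler0n.
  by rewrite exprS -mulmxE; exact: mulmx_nonneg.
elim: n i => [|n ih] i; first by rewrite !expr0 !mxE.
rewrite !exprS -!mulmxE !mxE lt0r => /andP[+ _].
rewrite psumr_neq0 => [/hasP[k _ /= ]|k _]; last first.
  by rewrite mulr_ge0 ?p_stoch.1 // An0 //; exact: p_stoch.1.
move=> h; have pik : 0 < p i k.
  by apply: stochastic_gt0; apply: contraTneq h => ->; rewrite mul0r ltxx.
move: h; rewrite pmulr_rgt0 // => /ih h.
rewrite (bigD1 k) //= ltr_pwDl //; first by rewrite mulr_gt0 // mx_powR_gt0.
by apply: sumr_ge0 => m _; rewrite mulr_ge0 // An0.
Qed.

(** It suffices that [N] exceed one hitting time for each pair of states; these come from [p] alone,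
    whence the uniformity in [theta]. *)
Lemma irreducible_sum_exp_pos : exists N, forall theta,
  mx_pos (\sum_(n < N) A theta ^+ n).
Proof.
have /choice[f fP] ij : exists n, 0 < (p ^+ n) ij.1 ij.2 := p_irr ij.1 ij.2.
exists (\max_ij f ij).+1 => theta i j.
have lt : (f (i, j) < (\max_ij f ij).+1)%N by rewrite ltnS leq_bigmax.
rewrite summxE (bigD1 (Ordinal lt)) //= ltr_pwDl //.
  exact: mx_powR_exp_gt0 (fP (i, j)).
apply: sumr_ge0 => n _; elim: (n : nat) i j {lt} => [|m ih] i j.
  by rewrite expr0 mxE ler0n.
by rewrite exprS -mulmxE mulmx_nonneg //; exact: mx_powR_nonneg.
Qed.

Lemma rho_perron_family : exists lv rv : R -> 'I_K -> R,
  forall theta, perron (A theta) (rho p theta) (lv theta) (rv theta).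
Proof.
have [N B0] := irreducible_sum_exp_pos.
have /choice[f fP] theta : exists lr : ('I_K -> R) * ('I_K -> R),
    perron (A theta) (rho p theta) lr.1 lr.2.
  have [t [l [r h]]] := perron_exists K0 (mx_powR_nonneg theta) (B0 theta).
  by exists (l, r); rewrite (rho_perron (mx_powR_nonneg theta) h).
by exists (fun theta => (f theta).1), (fun theta => (f theta).2).
Qed.

Lemma rho_gt0 theta : 0 < rho p theta.
Proof.
have [lv [rv /(_ theta)[l0 r0 _ Ar _]]] := rho_perron_family.
have [j pj] := stochastic_next (Ordinal K0).
rewrite -(pmulr_lgt0 _ (r0 (Ordinal K0))) -Ar (bigD1 j) //= ltr_pwDl //.
  by rewrite mulr_gt0 // mx_powR_gt0.
by apply: sumr_ge0 => k _; rewrite mulr_ge0 ?mx_powR_nonneg // ltW.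
Qed.

(** The comparison is multiplicative because both [perron_eigenvalue_le] and [perron_right_stable]
    take a factor [k], which then tends to 1 with [theta' - theta]. *)
Lemma mx_powR_lipschitz : exists2 C : R, 0 <= C & forall theta theta' i j,
  A theta' i j <= expR (C * `|theta' - theta|) * A theta i j.
Proof.
exists (\sum_i \sum_j `|ln (p i j)|).
  by apply: sumr_ge0 => i _; exact: sumr_ge0.
move=> theta theta' i j.
have [/eqP p0|/stochastic_gt0 pij] := boolP (p i j == 0).
  by rewrite !mxE p0 eqxx mulr0.
rewrite !mx_powR_expR // -expRD ler_expR -lerBlDr -mulrBl.
rewrite (le_trans (ler_norm _)) // normrM mulrC ler_wpM2r //.
rewrite (bigD1 i) //= (bigD1 j) //= -addrA lerDl addr_ge0 // sumr_ge0 // => k _.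
by rewrite sumr_ge0.
Qed.

Lemma is_derive_mx_powR (theta : R) i j :
  is_derive theta 1 (fun x : R => A x i j) (A theta i j * ln (p i j)).
Proof.
have [/eqP p0|/stochastic_gt0 pij] := boolP (p i j == 0).
  rewrite (_ : (fun x => _) = cst 0); last by apply/funext => x;
    rewrite mxE p0 eqxx.
  by rewrite mxE p0 eqxx mul0r; exact: is_derive_cst.
rewrite (_ : (fun x => _) = expR \o (fun x : R => x * ln (p i j))).
  rewrite mx_powR_expR //; apply: is_derive_eq.
  by rewrite scaler0 add0r /GRing.scale /= mulr1 mulrC.
by apply/funext => x /=; rewrite mx_powR_expR.
Qed.

Lemma is_derive1_cvgP (f : R -> R) (a df : R) :
  is_derive a 1 f df <-> t^-1 * (f (t + a) - f a) @[t --> 0^'] --> df.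
Proof.
have E : (fun t : R => t^-1 *: ((f \o shift a) (t *: (1 : R)) - f a)) =
    (fun t => t^-1 * (f (t + a) - f a)).
  by apply/funext => t; rewrite /= /GRing.scale /= mulr1.
split => [[df1 df2]|cv].
  by rewrite -df2 /derive -E; exact: df1.
by apply: DeriveDef; rewrite /derivable /derive E;
  [exact: cvgP cv|exact: cvg_lim cv].
Qed.

Let cvg_expR_norm (c : R) : expR (c * `|t|) @[t --> (0 : R)^'] --> (1 : R).
Proof.
apply: cvg_within_filter.
have : expR (c * `|t|) @[t --> (0 : R)] --> expR (c * `|0 : R|).
  apply: (@cvg_comp _ _ _ (fun t : R => c * `|t|) expR);
    last exact: continuous_expR.
  by apply: cvgM; [exact: cvg_cst|exact: norm_continuous].
by rewrite normr0 mulr0 expR0.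
Qed.

(** The eigenvectors at [t + theta], rescaled by the fixed [l], are almost subinvariant for the
    matrix at [theta], so [perron_right_stable] forces them towards [r]. *)
Let perron_right_cvg theta l r : perron (A theta) (rho p theta) l r ->
  exists x : R -> 'I_K -> R, [/\ forall t, \sum_i l i * x t i = 1,
    forall t i, \sum_j A (t + theta) i j * x t j = rho p (t + theta) * x t i &
    forall i, x t i @[t --> 0^'] --> r i].
Proof.
move=> h0; have [l0 r0 lA Ar lr1] := h0.
have [N B0] := irreducible_sum_exp_pos.
have [x [x0 lx1 Ax]] : exists x : R -> 'I_K -> R, [/\ forall t i, 0 < x t i,
    forall t, \sum_i l i * x t i = 1 &
    forall t i, \sum_j A (t + theta) i j * x t j = rho p (t + theta) * x t i].
  have [lv [rv h]] := rho_perron_family.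
  have s0 t : 0 < \sum_j l j * rv t j.
    by apply: sum_pos_gt0 => // i; rewrite mulr_gt0 // (perron_right_gt0 (h t)).
  exists (fun t i => rv (t + theta) i / \sum_j l j * rv (t + theta) j);
    split => [t i|t|t i].
  - by rewrite divr_gt0 // (perron_right_gt0 (h _)).
  - by under eq_bigr do rewrite mulrA; rewrite -mulr_suml divff // gt_eqF.
  - rewrite [RHS]mulrA -(perron_right (h (t + theta))) mulr_suml.
    by apply: eq_bigr => j _; rewrite mulrA.
exists x; split => // i.
have [D DP] := perron_right_stable K0 (@mx_powR_nonneg theta) (ltW (rho_gt0 _))
  (B0 theta) h0.
have [C C0 mx_powR_le] := mx_powR_lipschitz.
(* The factor is [k = expR (2 * C * |t|)]: one [expR (C * |t|)] for replacing the matrix, another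
   for replacing its eigenvalue. *)
have xle t : `|x t i - r i| <= D * (expR (N%:R * (2 * C) * `|t|) - 1).
  rewrite -mulrA expRM_natl.
  apply: DP => // [|j]; first by rewrite -expR0 ler_expR mulr_ge0 // mulr_ge0.
  apply: (@le_trans _ _ (\sum_k expR (C * `|t|) * (A (t + theta) j k * x t k))).
    apply: ler_sum => k _; rewrite mulrA ler_wpM2r ?(ltW (x0 _ _)) //.
    by have := mx_powR_le (t + theta) theta j k; rewrite distrC addrK.
  have -> : \sum_k expR (C * `|t|) * (A (t + theta) j k * x t k) =
      expR (C * `|t|) * rho p (t + theta) * x t j
        by rewrite -mulrA -Ax mulr_sumr.
  apply: ler_wpM2r; first exact: ltW.
  have hr : rho p (t + theta) <= expR (C * `|t|) * rho p theta.
    have [lv [rv h]] := rho_perron_family.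
    apply: perron_eigenvalue_le K0 (h theta) (h (t + theta)) _ => a b.
    by have := mx_powR_le theta (t + theta) a b; rewrite addrK.
  have -> : 2 * C * `|t| = C * `|t| + C * `|t| by ring.
  by rewrite expRD -[leRHS]mulrA ler_wpM2l ?expR_ge0.
have D0 : D * (expR (N%:R * (2 * C) * `|t|) - 1) @[t --> (0 : R)^'] --> (0 : R).
  have : D * (expR (N%:R * (2 * C) * `|t|) - 1) @[t --> (0 :
    R)^'] --> D * (1 - 1).
    apply: cvgM; first exact: cvg_cst.
    by apply: cvgB; [exact: cvg_expR_norm|exact: cvg_cst].
  by rewrite subrr mulr0.
apply: (@squeeze_cvgr _ _ _ _ (fun t => r i - D * (expR (N%:R * (2 * C) * `|t|)
  - 1))
  (fun t => r i + D * (expR (N%:R * (2 * C) * `|t|) - 1))).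
- by near=> t; have := xle t; rewrite ler_distl.
- rewrite -[r i in X in _ --> X]subr0.
  by apply: cvgB D0; exact: cvg_cst.
- rewrite -[r i in X in _ --> X]addr0.
  by apply: cvgD D0; exact: cvg_cst.
Unshelve. all: by end_near. Qed.

(** As [l (x t) = 1], the difference quotient of [rho] is exactly [l] times that of the matrix times
    [x t]. Convergence of [x t] is thus enough, and no derivative of an eigenvector appears. *)
Lemma is_derive_rho theta l r : perron (A theta) (rho p theta) l r ->
  is_derive theta 1 (rho p) (\sum_i \sum_j l i * (A theta i j * ln (p i j)) * r
    j).
Proof.
move=> h0; have [l0 r0 lA Ar lr1] := h0.
have [x [lx1 Ax xr]] := perron_right_cvg h0.
have key t : t^-1 * (rho p (t + theta) - rho p theta) =
    \sum_i \sum_j l i * (t^-1 * (A (t + theta) i j - A theta i j)) * x t j.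
  transitivity (t^-1 * (\sum_i \sum_j l i * A (t + theta) i j * x t j -
                        \sum_i \sum_j l i * A theta i j * x t j)).
    congr (_ * (_ - _)).
      rewrite -[LHS]mulr1 -(lx1 t) mulr_sumr; apply: eq_bigr => i _.
      rewrite mulrCA -Ax mulr_sumr; apply: eq_bigr => j _; by rewrite mulrA.
    rewrite exchange_big /= -[LHS]mulr1 -(lx1 t) mulr_sumr;
      apply: eq_bigr => j _.
    by rewrite mulrA -lA mulr_suml.
  rewrite -sumrB mulr_sumr; apply: eq_bigr => i _.
  rewrite -sumrB mulr_sumr; apply: eq_bigr => j _; ring.
apply/is_derive1_cvgP; under eq_fun do rewrite key.
apply: (@cvg_big R _ +%R 0 xpredT _ _ _ _ _
  (fun i => \sum_j l i * (A theta i j * ln (p i j)) * r j)).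
  exact: (@add_continuous R).
move=> i _; apply: (@cvg_big R _ +%R 0 xpredT _ _ _ _ _
  (fun j => l i * (A theta i j * ln (p i j)) * r j)).
  exact: (@add_continuous R).
move=> j _; apply: cvgM => //; apply: cvgM; first exact: cvg_cst.
by apply/(is_derive1_cvgP (fun x => A x i j)); exact: is_derive_mx_powR.
Qed.

End PerronFamily.

(** * Slope of the Perron eigenvalue at minus infinity *)

Section NonDeterministic.
Context {R : realType} {K : nat} (p : 'M[R]_K).
Hypotheses (K2 : (2 <= K)%N) (p_stoch : stochastic p)
  (p_irr : irreducible_chain p) (p_aper : aperiodic_chain p).

(** Otherwise [p] is the matrix of a map [s]. Irreducibility makes [s] a single cycle, aperiodicity
    makes its length 1, and then there is only one state. *)
Lemma aperiodic_entry_lt1 : exists i j, 0 < p i j < 1.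
Proof.
apply: contrapT => nex.
have p1 i j : 0 < p i j -> p i j = 1.
  move=> pij; apply: contrapT => /eqP pn1; apply: nex; exists i, j.
  by rewrite pij lt_neqAle pn1 stochastic_le1.
have /choice[s sP] i : exists j, 0 < p i j by exact: stochastic_next.
have pE i j : p i j = (j == s i)%:R.
  have [->|jn] := eqVneq; first exact: p1.
  apply/eqP; apply: contraT => /(stochastic_gt0 p_stoch)/p1 pij.
  have := p_stoch.2 i; rewrite (bigD1 j) //= (bigD1 (s i)) 1?eq_sym //= pij p1 //.
  set S := \sum_(_ | _) _ => e.
  have S0 : 0 <= S by apply: sumr_ge0 => k _; exact: p_stoch.1.
  by exfalso; lra.
have pnE n i j : (p ^+ n) i j = (j == iter n s i)%:R.
  elim: n i => [|n ih] i; first by rewrite expr0 mxE eq_sym.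
  rewrite exprS -mulmxE mxE (bigD1 (s i)) //= pE eqxx mul1r ih -iterSr.
  rewrite big1 ?addr0 // => k kn; by rewrite pE (negbTE kn) mul0r.
have reach i j : exists n, iter n s i == j.
  by have [n] := p_irr i j; rewrite pnE eq_sym ltr0n lt0b; exists n.
have i : 'I_K := Ordinal (ltnW K2).
have ret : exists n, (0 < n)%N && (iter n s i == i).
  by have [n /eqP h] := reach (s i) i; exists n.+1; rewrite iterSr h eqxx.
case: (ex_minnP ret) => n0 /andP[n00 /eqP n0i] n0min.
(* The least return time divides every return time, since the remainder would be a shorter
   return. *)
have n01 : n0 = 1%N.
  apply: (p_aper (i := i)) => n _; rewrite pnE ltr0n lt0b eq_sym => /eqP ni.
  have qi q : iter (q * n0) s i = i.
    by elim: q => [|q ih] //; rewrite mulSn iterD ih.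
  move: ni; rewrite (divn_eq n n0) addnC iterD qi => ri.
  rewrite dvdn_addl ?dvdn_mull // /dvdn modn_mod.
  have [//|r0] := posnP (n %% n0).
  have := n0min (n %% n0)%N; rewrite r0 ri eqxx => /(_ isT).
  by rewrite leqNgt ltn_mod n00.
have si : s i = i by move: n0i; rewrite n01.
have fix_i n : iter n s i = i by elim: n => [|n ih] //=; rewrite ih.
have allE j : j = i by have [n /eqP <-] := reach i j.
have := allE (Ordinal K2); rewrite -(allE (Ordinal (ltnW K2))) => /(congr1 val).
by [].
Qed.

End NonDeterministic.

(** * Bounds on [ln rho] and its slope *)

Section Pressure.
Context {R : realType} {K : nat} (p : 'M[R]_K).
Hypotheses (K2 : (2 <= K)%N) (p_stoch : stochastic p)
  (p_irr : irreducible_chain p) (p_aper : aperiodic_chain p).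
Local Notation A := (mx_powR p).
Let K0 : (0 < K)%N := ltnW K2.

(** The weights [l_i M_ij r_j] have inflow and outflow [t l_i r_i] at every state, so the
    differences of [g] cancel, and their total mass is [t]. *)
Lemma perron_flow (M : 'M[R]_K) t l r c (g : 'I_K -> R) : perron M t l r ->
  \sum_i \sum_j l i * M i j * r j * (c + g i - g j) = t * c.
Proof.
move=> [l0 r0 lM Mr lr1].
transitivity (\sum_i \sum_j l i * M i j * r j * (c + g i) -
              \sum_i \sum_j l i * M i j * r j * g j).
  rewrite -sumrB; apply: eq_bigr => i _; rewrite -sumrB;
    apply: eq_bigr => j _; ring.
have -> : \sum_i \sum_j l i * M i j * r j * g j = t * \sum_j l j * r j * g j.
  rewrite exchange_big mulr_sumr /=; apply: eq_bigr => j _.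
  rewrite -mulr_suml -mulr_suml lM; ring.
have -> : \sum_i \sum_j l i * M i j * r j * (c + g i) = t * \sum_i l i * r i *
  (c + g i).
  rewrite mulr_sumr; apply: eq_bigr => i _; rewrite -mulr_suml.
  under eq_bigr do rewrite -mulrA; rewrite -mulr_sumr Mr; ring.
under [X in t * X - _]eq_bigr do rewrite mulrDr.
by rewrite big_split /= -mulr_suml lr1 mul1r mulrDr addrK.
Qed.

Lemma derive1_rho theta l r : perron (A theta) (rho p theta) l r ->
  - derive1 (rho p) theta = \sum_i \sum_j l i * A theta i j * r j * - ln (p i
    j).
Proof.
move=> h; have [_ dE] := is_derive_rho K0 p_stoch p_irr h.
rewrite derive1E dE -sumrN; apply: eq_bigr => i _.
rewrite -sumrN; apply: eq_bigr => j _; ring.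
Qed.

Lemma perron_log_edge theta l r i j : perron (A theta) (rho p theta) l r ->
  0 < p i j -> theta * ln (p i j) + ln (r j) <= ln (rho p theta) + ln (r i).
Proof.
move=> [l0 r0 lA Ar lr1] pij.
have t0 := rho_gt0 K0 p_stoch p_irr theta.
rewrite -(expRK (theta * _)) -mx_powR_expR // -!lnM ?posrE ?mx_powR_gt0 //.
rewrite ler_ln ?posrE ?mulr_gt0 ?mx_powR_gt0 // -Ar (bigD1 j) //= lerDl.
by apply: sumr_ge0 => k _; rewrite mulr_ge0 ?mx_powR_nonneg // ltW.
Qed.

(* The edge weights [l_i A_ij r_j] form a circulation, so the potential [ln r']
   of another parameter cancels out. *)
Lemma derive1_rho_le theta theta' : 0 <= - theta' ->
  - derive1 (rho p) theta * - theta' <= rho p theta * ln (rho p theta').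
Proof.
move=> t'0; have [lv [rv h]] := rho_perron_family K0 p_stoch p_irr.
rewrite (derive1_rho (h theta)) -(perron_flow _ (fun i => ln (rv theta' i)) (h
  theta)).
rewrite mulr_suml ler_sum // => i _; rewrite mulr_suml ler_sum // => j _.
rewrite -[leLHS]mulrA.
have [/eqP p0|/(stochastic_gt0 p_stoch) pij] := boolP (p i j == 0).
  by rewrite mxE p0 eqxx mulr0 !mul0r.
rewrite ler_wpM2l //.
  by rewrite !mulr_ge0 ?mx_powR_nonneg ?(ltW (perron_left_gt0 (h _) _)) ?(ltW
    (perron_right_gt0 (h _) _)).
by rewrite mulrNN mulrC lerBrDr; exact: perron_log_edge.
Qed.

(* Gibbs' inequality for the transition matrix [A_ij r_j / (rho r_i)] against
   [p]. *)
Lemma derive1_rho_ge theta :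
  rho p theta * ln (rho p theta) <= (1 - theta) * - derive1 (rho p) theta.
Proof.
have [lv [rv h]] := rho_perron_family K0 p_stoch p_irr.
have := h theta; set l := lv theta; set r := rv theta;
  set t := rho p theta => ht.
have [l0 r0 lA Ar lr1] := ht.
have t0 : 0 < t by exact: rho_gt0.
rewrite (derive1_rho ht) -subr_le0 -(perron_flow _ (fun i => ln (r i)) ht)
  mulr_sumr -sumrB.
apply: (@le_trans _ _ (\sum_i (l i * r i * t * \sum_j p i j - l i * \sum_j A
  theta i j * r j))).
  apply: ler_sum => i _; rewrite !mulr_sumr -!sumrB ler_sum // => j _.
  have [/eqP p0|/(stochastic_gt0 p_stoch) pij] := boolP (p i j == 0).
    by rewrite mxE p0 eqxx !(mulr0, mul0r, subr0).
  have A0 := mx_powR_gt0 theta pij.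
  (* [y] is [p i j] divided by the tilted transition probability. Under [ln y <= y - 1], the
     weighted right-hand sides cancel over each row because both matrices are stochastic. *)
  pose y := p i j * t * r i / (A theta i j * r j).
  have y0 : 0 < y by rewrite divr_gt0 ?mulr_gt0.
  have lny : ln y = ln (p i j) + ln t + ln (r i) - (theta * ln (p i j) + ln (r
    j)).
    rewrite ln_div ?posrE ?mulr_gt0 // !lnM ?posrE ?mulr_gt0 //.
    by rewrite (mx_powR_expR theta pij) expRK.
  have -> : l i * A theta i j * r j * (ln t + ln (r i) - ln (r j)) -
      (1 - theta) * (l i * A theta i j * r j * - ln (p i j)) =
      l i * (A theta i j * r j) * ln y by rewrite lny; ring.
  have -> : l i * r i * t * p i j - l i * (A theta i j * r j) =
      l i * (A theta i j * r j) * (y - 1).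
    by rewrite /y; field; rewrite !gt_eqF.
  rewrite ler_wpM2l //; first by rewrite !mulr_ge0 // ltW.
  have := @le_ln1Dx _ (y - 1); rewrite subrKC; apply.
  by rewrite ltrBrDl subrr.
rewrite big1 // => i _; rewrite p_stoch.2 Ar; ring.
Qed.

(** Entrywise [mx_powR p (-1)] dominates [p], strictly at an entry inside (0, 1). Pair its positive
    left eigenvector with the all-ones vector, which [p] fixes. *)
Lemma rho_gt1 : 1 < rho p (-1).
Proof.
have [lv [rv /(_ (-1))[l0 r0 lA Ar lr1]]] := rho_perron_family K0 p_stoch p_irr.
have [a [b /andP[pab pab1]]] := aperiodic_entry_lt1 K2 p_stoch p_irr p_aper.
have ple i j : p i j <= A (-1) i j.
  have [/eqP p0|/(stochastic_gt0 p_stoch) pij] := boolP (p i j == 0).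
    by rewrite mxE p0 eqxx.
  rewrite mx_powR_expR // -[leLHS]lnK ?posrE // ler_expR mulN1r.
  have := ln_le0 (stochastic_le1 p_stoch i j); lra.
have plt : p a b < A (-1) a b.
  rewrite mx_powR_expR // -[ltLHS]lnK ?posrE // ltr_expR mulN1r.
  have : ln (p a b) < 0 by rewrite ln_lt0 // pab.
  lra.
set l := lv (-1) in l0 lA lr1.
have s0 : 0 < \sum_i l i by exact: sum_pos_gt0.
rewrite -(ltr_pM2r s0) mul1r mulr_sumr.
under [ltRHS]eq_bigr do rewrite -lA.
rewrite exchange_big /=.
under [ltRHS]eq_bigr do rewrite -mulr_sumr.
under [ltLHS]eq_bigr => i _ do rewrite -[l i]mulr1 -(p_stoch.2 i).
have rowle i : l i * \sum_j p i j <= l i * \sum_j A (-1) i j.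
  by rewrite ler_pM2l // ler_sum.
rewrite (bigD1 a) //= [ltRHS](bigD1 a) //= ltr_leD //; last by apply: ler_sum.
rewrite ltr_pM2l // (bigD1 b) //= [ltRHS](bigD1 b) //= ltr_leD //.
by apply: ler_sum.
Qed.

Lemma pressure_slope : exists la : R, [/\ 0 < la,
  forall theta, theta < 0 ->
    la * - theta <= ln (rho p theta) <= la * (1 - theta) &
  forall theta, theta < 0 -> la * - theta / (1 - theta) <=
    - derive1 (rho p) theta / rho p theta <= la].
Proof.
pose E := [set ln (rho p theta) / - theta | theta in [set theta :
  R | theta < 0]].
have rp := rho_gt0 K0 p_stoch p_irr.
have lbE theta : lbound E (- derive1 (rho p) theta / rho p theta).
  move=> _ [theta' /= t'0 <-].
  have nt' : 0 < - theta' by rewrite oppr_gt0.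
  rewrite ler_pdivlMr // mulrAC ler_pdivrMr // [leRHS]mulrC.
  by rewrite derive1_rho_le // ltW.
have E0 : E !=set0 by exists (ln (rho p (-1)) / - (-1)); exists (-1) => //=;
  lra.
have hE : has_inf E by split => //; exists (- derive1 (rho p) 0 / rho p 0).
have s_le theta : - derive1 (rho p) theta / rho p theta <= inf E.
  by apply: lb_le_inf.
have f_ge theta : theta < 0 -> inf E * - theta <= ln (rho p theta).
  move=> t0; rewrite -ler_pdivlMr ?oppr_gt0 //; apply: ge_inf;
    first exact: hE.2.
  by exists theta.
have f_le theta : theta < 0 -> ln (rho p theta) <=
    - derive1 (rho p) theta / rho p theta * (1 - theta).
  by move=> t0; rewrite mulrAC ler_pdivlMr //
    [leLHS]mulrC [leRHS]mulrC derive1_rho_ge.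
exists (inf E); split.
(* At -1 the bounds read [0 < ln (rho p (-1)) <= 2 s(-1) <= 2 inf E], with [s = - rho' / rho]. *)
- have := f_le (-1) _; have := s_le (-1); have := ln_gt0 rho_gt1.
  set x := _ / _; move=> h1 h2 h3;
    have : ln (rho p (-1)) <= x * (1 - -1) by apply: h3; lra.
  lra.
- move=> theta t0; rewrite f_ge //= (le_trans (f_le _ t0)) // ler_wpM2r //.
  by rewrite subr_ge0 ltW // (lt_trans t0).
- move=> theta t0; rewrite s_le andbT ler_pdivrMr;
  last by rewrite subr_gt0 (lt_trans t0).
  by rewrite (le_trans (f_ge _ t0)) // f_le.
Qed.

End Pressure.

(** * Sizes of the boxes *)

Section BoxSizes.
Context {R : realType} {K : nat} (p : 'M[R]_K) (i0 : 'I_K).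
Hypotheses (K2 : (2 <= K)%N) (p_stoch : stochastic p) (p_irr :
  irreducible_chain p).
Let K0 : (0 < K)%N := ltnW K2.

Lemma box_rcons u k : box p i0 (rcons u k) =
  (k, box_size p i0 u * p (box p i0 u).1 k).
Proof. by rewrite /box_size /box foldl_rcons. Qed.

Lemma box_size_rcons u k :
  box_size p i0 (rcons u k) = box_size p i0 u * p (box p i0 u).1 k.
Proof. by rewrite {1}/box_size box_rcons. Qed.

Lemma box_size_ge0 u : 0 <= box_size p i0 u.
Proof.
elim/last_ind: u => [|u k ih]; first by rewrite /box_size /=.
by rewrite box_size_rcons mulr_ge0 // p_stoch.1.
Qed.

Lemma box_size_rcons_gt0 u k : 0 < box_size p i0 (rcons u k) ->
  0 < box_size p i0 u /\ 0 < p (box p i0 u).1 k.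
Proof.
rewrite box_size_rcons lt0r mulf_eq0 negb_or => /andP[/andP[un kn] _].
by rewrite !lt_def un kn box_size_ge0 p_stoch.1.
Qed.

Section Theta.
Variables (theta : R) (l r : 'I_K -> R).
Hypothesis lr : perron (mx_powR p theta) (rho p theta) l r.

(** [perron_log_edge] telescopes along the word. For negative [theta] this bounds the size from
    below. *)
Lemma box_size_log_le u : 0 < box_size p i0 u ->
  theta * ln (box_size p i0 u) + ln (r (box p i0 u).1) <=
  (size u)%:R * ln (rho p theta) + ln (r i0).
Proof.
elim/last_ind: u => [|u k ih]; first by rewrite /box_size /= ln1 mulr0 mul0r.
move=> /box_size_rcons_gt0[u0 pk]; rewrite box_size_rcons box_rcons /=.
rewrite lnM ?posrE // size_rcons -natr1.
have := ih u0; have := perron_log_edge K2 p_stoch p_irr lr pk; lra.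
Qed.

(** Among the [K] terms of [(A r)_i = rho r_i] one is at least the average, so that edge reverses
    [perron_log_edge] up to [ln K]. *)
Lemma perron_greedy_edge i : exists2 j, 0 < p i j &
  ln (rho p theta) - ln K%:R + ln (r i) <= theta * ln (p i j) + ln (r j).
Proof.
have [l0 r0 _ Ar _] := lr; have t0 := rho_gt0 K0 p_stoch p_irr theta.
have K0R : (0 : R) < K%:R by rewrite ltr0n.
have [j hj] : exists j, rho p theta * r i / K%:R <= mx_powR p theta i j * r j.
  apply/existsP; apply: contraT; rewrite negb_exists => /forallP h.
  suff : rho p theta * r i < rho p theta * r i by rewrite ltxx.
  rewrite -{1}Ar (lt_le_trans (_ :
    _ < \sum_(j < K) rho p theta * r i / K%:R)) //.
    apply: ltr_sum => [|j _]; last by rewrite ltNge.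
    by apply/hasP; exists i => //; exact: mem_index_enum.
  by rewrite sumr_const card_ord -[X in X <= _]mulr_natr divfK // gt_eqF.
have pij : 0 < p i j.
  apply: stochastic_gt0 => //; apply: contraTneq hj => p0.
  by rewrite mxE p0 eqxx mul0r -ltNge divr_gt0 // mulr_gt0.
exists j => //; move: hj.
rewrite -ler_ln ?posrE ?divr_gt0 ?mulr_gt0 ?mx_powR_gt0 //.
rewrite ln_div ?posrE ?mulr_gt0 // !lnM ?posrE ?mx_powR_gt0 //
  mx_powR_expR // expRK.
lra.
Qed.

(** Follow greedy edges from the root. The loss [ln K] per generation becomes negligible after
    division by a large [- theta]. *)
Lemma box_size_log_ge n : exists u, [/\ size u = n, 0 < box_size p i0 u &
  n%:R * (ln (rho p theta) - ln K%:R) + ln (r i0) <=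
  theta * ln (box_size p i0 u) + ln (r (box p i0 u).1)].
Proof.
elim: n => [|n [u [un u0 hu]]].
  by exists [::]; split => //; rewrite /box_size /= ?ln1 ?mulr0 ?mul0r.
have [k pk hk] := perron_greedy_edge (box p i0 u).1.
exists (rcons u k); rewrite size_rcons un box_size_rcons box_rcons /=;
  split => //.
  by rewrite mulr_gt0.
rewrite lnM ?posrE // -natr1; lra.
Qed.

End Theta.

Variable la : R.
Hypotheses (la0 : 0 < la)
  (laP : forall theta, theta < 0 ->
    la * - theta <= ln (rho p theta) <= la * (1 - theta)).

Lemma box_size_lower e : 0 < e -> exists c, forall u, 0 < box_size p i0 u ->
  - c - (la + e) * (size u)%:R <= ln (box_size p i0 u).
Proof.
(* At [theta = - s], division by [s] gives the rate [la * (1 + s) / s], which is [la + e] for this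
   [s]. *)
move=> e0; pose s := la / e; have s0 : 0 < s by rewrite divr_gt0.
have [lv [rv /(_ (- s)) h]] := rho_perron_family K0 p_stoch p_irr.
set r := rv (- s) in h.
have ns0 : - s < 0 by rewrite oppr_lt0.
have /andP[_ fle] := laP ns0.
exists ((\sum_i `|ln (r i0) - ln (r i)|) / s) => u u0.
have hu := box_size_log_le h u0.
have hc : ln (r i0) - ln (r (box p i0 u).1) <= \sum_i `|ln (r i0) - ln (r i)|.
  by rewrite (bigD1 (box p i0 u).1) //= (le_trans (ler_norm _)) //
    lerDl sumr_ge0.
set c := \sum_i _ in hc *; set x := ln (box_size p i0 u) in hu *.
set n := (size u)%:R in hu *.
have n0 : 0 <= n by rewrite ler0n.
have nf : n * ln (rho p (- s)) <= n * (la * (1 - - s)) by rewrite ler_wpM2l.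
rewrite -(ler_pM2l s0) mulrBr mulrN [s * (c / s)]mulrC divfK ?gt_eqF //.
have -> : s * ((la + e) * n) = n * (la * (1 - - s)).
  by rewrite /s; field; rewrite gt_eqF.
lra.
Qed.

Lemma box_size_upper e : 0 < e -> exists c, forall n, exists u,
  [/\ size u = n, 0 < box_size p i0 u &
      ln (box_size p i0 u) <= c - (la - e) * n%:R].
Proof.
move=> e0; have K1 : (1 : R) <= K%:R by rewrite ler1n.
(* This makes [ln K / s < e], so at [theta = - s] the greedy loss lowers the rate [la] by less than
   [e]. *)
pose s := (ln K%:R + e) / e;
  have s0 : 0 < s by rewrite divr_gt0 // ltr_wpDl // ln_ge0.
have [lv [rv /(_ (- s)) h]] := rho_perron_family K0 p_stoch p_irr.
set r := rv (- s) in h.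
have ns0 : - s < 0 by rewrite oppr_lt0.
have /andP[fge _] := laP ns0.
exists ((\sum_i `|ln (r i) - ln (r i0)|) / s) => n.
have [u [un u0 hu]] := box_size_log_ge h n; exists u; split => //.
have hc : ln (r (box p i0 u).1) - ln (r i0) <= \sum_i `|ln (r i) - ln (r i0)|.
  by rewrite (bigD1 (box p i0 u).1) //= (le_trans (ler_norm _)) //
    lerDl sumr_ge0.
set c := \sum_i _ in hc *; set x := ln (box_size p i0 u) in hu *.
have n0 : (0 : R) <= n%:R by rewrite ler0n.
rewrite -(ler_pM2l s0) mulrBr [s * (c / s)]mulrC divfK ?gt_eqF //.
have es : e * s = ln K%:R + e by rewrite /s mulrC divfK // gt_eqF.
have : n%:R * (s * (la - e)) <= n%:R * (ln (rho p (- s)) - ln K%:R).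
  rewrite ler_wpM2l //; lra.
lra.
Qed.

(** Inverting the two bounds squeezes the ratio between [1 / la] and
    [1 / la + 1 / (la * - theta)]. *)
Lemma Cstar_ratio_cvg :
  (forall theta, theta < 0 -> la * - theta / (1 - theta) <=
    - derive1 (rho p) theta / rho p theta <= la) ->
  Cstar_ratio p theta @[theta --> -oo] --> la^-1.
Proof.
move=> sP; apply/cvgrPdist_le => e e0; near=> theta.
have t0 : theta < 0 by near: theta; exact: nbhs_ninfty_lt.
have te : theta <= - (la^-1 / e) by near: theta; apply: nbhs_ninfty_le;
  exact: num_real.
have nt0 : 0 < - theta by rewrite oppr_gt0.
have t1 : 0 < 1 - theta by rewrite subr_gt0 (lt_trans t0).
have /andP[h1 h2] := sP _ t0.
have -> : Cstar_ratio p theta = (- derive1 (rho p) theta / rho p theta)^-1.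
  by rewrite /Cstar_ratio invf_div.
set s := _ / rho p theta in h1 h2 *.
have s0 : 0 < s by rewrite (lt_le_trans _ h1) // divr_gt0 // mulr_gt0.
have h3 : la^-1 <= s^-1 by rewrite lef_pV2 ?posrE.
have h4 : s^-1 <= (la * - theta / (1 - theta))^-1.
  by rewrite lef_pV2 ?posrE // divr_gt0 // mulr_gt0.
have h5 : (la * - theta / (1 - theta))^-1 = la^-1 + la^-1 / - theta.
  by field; rewrite (lt_eqF t0) (gt_eqF la0) (gt_eqF t1).
rewrite ler0_norm ?subr_le0 // opprB lerBlDl (le_trans h4) // h5 lerD2l.
rewrite ler_pdivrMr // mulrC -ler_pdivrMr //; lra.
Unshelve. all: by end_near. Qed.

End BoxSizes.

(** * Balls *)

(** Completing the square. It turns a bound [expR (a k - b k ^+ 2)] into a constant times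
    [expR (- k)], as geometric summation demands. *)
Lemma quadratic_le_linear (R : realFieldType) (a b x : R) : 0 < b ->
  a * x - b * x ^+ 2 <= (a + 1) ^+ 2 / (4 * b) - x.
Proof.
move=> b0; rewrite -subr_ge0.
have -> : (a + 1) ^+ 2 / (4 * b) - x - (a * x - b * x ^+ 2) =
    b * (x - (a + 1) / (2 * b)) ^+ 2 by field; rewrite gt_eqF.
by rewrite mulr_ge0 ?sqr_ge0 // ltW.
Qed.

(** * Union bound and Borel-Cantelli lemma *)

Section BorelCantelli.
Context {R : realType} {d : measure_display} {T : measurableType d}.
Variable P : probability T R.

Lemma probability_bigsetU_le (I : Type) (s : seq I) (Q : pred I) (F :
  I -> set T) :
  (forall i, measurable (F i)) ->
  (P (\big[setU/set0]_(i <- s | Q i) F i) <= \sum_(i <- s | Q i) P (F i))%E.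
Proof.
move=> mF; elim: s => [|i s ih]; first by rewrite !big_nil measure0.
rewrite !big_cons; case: ifP => // _.
rewrite (le_trans (measureU2 _ (mF i) _)) //; first exact: bigsetU_measurable.
by rewrite leeD2l.
Qed.

Lemma geometric_borel_cantelli (F : (set T)^nat) (C z : R) :
  0 <= C -> 0 < z < 1 ->
  (forall k, measurable (F k)) -> (forall k, (P (F k) <= (C * z ^+ k)%:E)%E) ->
  {ae P, forall w, exists k0, forall k, (k0 <= k)%N -> ~ F k w}.
Proof.
move=> C0 /andP[z0 z1] mF PF; exists (lim_sup_set F); split.
- by apply: bigcapT_measurable => n; apply: bigcup_measurable.
- apply: lim_sup_set_cvg0 => //.
  apply: (@le_lt_trans _ _ (C / (1 - z))%:E); last exact: ltry.
  apply: lime_le; first by apply: is_cvg_nneseries => n _ _; exact: measure_ge0.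
  near=> n; apply: (@le_trans _ _ (\sum_(0 <= k < n) (C * z ^+ k)%:E)%E).
    by apply: lee_sum => k _; exact: PF.
  rewrite sumEFin lee_fin; apply: le_trans (@geometric_le_lim _ n C z C0 z0 _).
    by rewrite /series /geometric.
  by rewrite gtr0_norm.
- move=> w /= h n _; apply: contrapT => hn; apply: h; exists n => k nk Fk.
  by apply: hn; exists k.
Unshelve. all: by end_near. Qed.

End BorelCantelli.

(** * Occupation of the boxes and almost sure growth of the first deficient generation *)

Section BallsInBoxes.
Context {R : realType} {K : nat} {d : measure_display} {T : measurableType d}.
Variables (p : 'M[R]_K) (i0 : 'I_K) (P : probability T R) (X :
  nat -> nat -> T -> 'I_K).
Hypotheses (p_stoch : stochastic p) (hX : balls_process p i0 P X).
Local Notation q := (box_size p i0).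

Lemma probability_ball_in r u : 0 < q u -> P (ball_in X r u) = (q u)%:E.
Proof.
elim/last_ind: u => [|u k ih].
  move=> _; rewrite (_ : ball_in X r [::] = setT) ?probability_setT //.
  by apply/seteqP; split.
move=> uk0; have [u0 _] := box_size_rcons_gt0 p_stoch uk0.
rewrite (balls_fall hX) // ih // -EFinM; congr EFin.
by rewrite mulrC divfK // gt_eqF.
Qed.

Lemma box_size_le1 u : 0 < q u -> q u <= 1.
Proof.
move=> u0; rewrite -lee_fin -(probability_ball_in 0) // probability_le1 //.
exact: balls_measurable hX _ _.
Qed.

Lemma measurable_ball_in r u : measurable (ball_in X r u).
Proof. exact: balls_measurable hX _ _. Qed.

Lemma probability_no_ball (s : seq nat) u : uniq s -> 0 < q u ->
  P (\bigcap_(r in [set` s]) ~` ball_in X r u) = ((1 - q u) ^+ size s)%:E.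
Proof.
move=> us u0; rewrite (balls_indep hX) //; last first.
  move=> r _; rewrite /ball_sigma -setTD; apply: sigma_algebraCD.
  by apply: sub_sigma_algebra; exists u.
elim: s {us} => [|r s ih]; first by rewrite big_nil.
rewrite big_cons ih probability_setC; last exact: measurable_ball_in.
by rewrite probability_ball_in // exprS EFinM EFinB.
Qed.

Lemma probability_no_ball_le (s : seq nat) u : uniq s -> 0 < q u ->
  (P (\bigcap_(r in [set` s]) ~` ball_in X r u) <=
   (expR (- (q u * (size s)%:R)))%:E)%E.
Proof.
move=> us u0; rewrite probability_no_ball // lee_fin -mulNr mulrC expRM_natl.
by rewrite lerXn2r ?nnegrE ?expR_ge0 ?subr_ge0 ?box_size_le1 // expR_ge1Dx.
Qed.

(** The blocks of [M] consecutive balls are disjoint, so one hit in each of [j] blocks gives [j]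
    different balls; division by [M] recovers the block. *)
Lemma nb_balls_ge (j M m : nat) u w : (j * M <= m)%N ->
  (forall g, (g < j)%N -> exists2 r, r \in iota (g * M) M & ball_in X r u w) ->
  (j <= nb_balls X m u w)%N.
Proof.
move=> jMm h.
have /choice[f fP] (g : 'I_j) : exists r : 'I_m, (r :
  nat) \in iota (g * M) M /\ ball_in X r u w.
  have [r rg rw] := h g (ltn_ord g).
  have rm : (r < m)%N.
    apply: leq_trans jMm; move: rg; rewrite mem_iota => /andP[_ rg].
    by apply: leq_trans rg _; rewrite -mulSnr leq_mul2r ltn_ord orbT.
  by exists (Ordinal rm).
have fE g : (f g %/ M)%N = g.
  have [+ _] := fP g; rewrite mem_iota => /andP[a b].
  have M0 : (0 < M)%N.
    by have := leq_ltn_trans a b; rewrite -[X in (X < _)%N]addn0 ltn_add2l.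
  by rewrite -(subnKC a) divnMDl // divn_small ?addn0 // ltn_subLR.
have finj : injective f.
  by move=> g g' fgg'; apply: val_inj; rewrite /= -(fE g) -(fE g') fgg'.
rewrite /nb_balls -{1}(card_ord j) -(card_codom finj); apply: subset_leq_card.
by apply/fintype.subsetP => r /codomP[g ->]; rewrite inE; have [_ /eqP] := fP g.
Qed.

(** A deficient box has a child of positive size, and every ball in the child is in the parent. *)
Lemma deficient_generation_mono m j w n n' : (n <= n')%N ->
  deficient_generation p i0 X m j w n -> deficient_generation p i0 X m j w n'.
Proof.
move=> /subnKC <-; elim: (n' - n)%N => [|k ih]; first by rewrite addn0.
move=> /ih[u [un u0 uj]]; have [i pi] := stochastic_next p_stoch (box p i0 u).1.
exists (rcons u i); split; first by rewrite size_rcons un addnS.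
  by rewrite box_size_rcons mulr_gt0.
apply: leq_ltn_trans uj; apply: subset_leq_card; apply/fintype.subsetP => r.
rewrite !inE size_rcons /ball_box mkseqS => /eqP /rcons_inj[<- _].
by rewrite size_mkseq.
Qed.

(** The deficient [n'] provides a least deficient generation, so [xget] does not return its default;
    monotonicity puts that generation beyond [n]. *)
Lemma first_deficient_bounds m j w n n' :
  ~ deficient_generation p i0 X m j w n ->
  deficient_generation p i0 X m j w n' ->
  (n < first_deficient p i0 X m j w <= n')%N.
Proof.
move=> nd d'; rewrite /first_deficient; case: xgetP => [g _ [dg gmin]|none].
  rewrite gmin // andbT ltnNge; apply/negP => gn; apply: nd.
  exact: deficient_generation_mono gn dg.
exfalso; have ex : exists n, `[< deficient_generation p i0 X m j w n >].
  by exists n'; apply/asboolP.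
case: (ex_minnP ex) => g /asboolP dg gmin; apply: (none g); split => // k dk.
by apply: gmin; apply/asboolP.
Qed.

Variables (la : R) (j : nat).
Hypotheses (la0 : 0 < la) (j0 : (0 < j)%N).
Hypothesis lower : forall e, 0 < e -> exists c, forall u, 0 < q u ->
  - c - (la + e) * (size u)%:R <= ln (q u).
Hypothesis upper : forall e, 0 < e -> exists c, forall n, exists u,
  [/\ size u = n, 0 < q u & ln (q u) <= c - (la - e) * n%:R].

(** Union bound over [2 ^ k] balls for the small box of generation just above [be k]: with [e] half
    of the slack in [ln 2 < be * la], the probability that it is hit decays geometrically. An empty
    box is deficient because [0 < j]. *)
Lemma ae_deficient be : 0 < be -> ln 2 < be * la ->
  {ae P, forall w, exists k0, forall k m, (k0 <= k)%N -> (m <= 2 ^ k)%N ->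
    deficient_generation p i0 X m j w (Num.truncn (be * k%:R)).+1}.
Proof.
move=> be0 hbe; pose e := (la - ln 2 / be) / 2.
have e0 : 0 < e by rewrite divr_gt0 // subr_gt0 ltr_pdivrMr // mulrC.
have hq : 0 < be * (la - e) - ln 2.
  have -> : be * (la - e) - ln 2 = (be * la - ln 2) / 2.
    by rewrite /e; field; rewrite gt_eqF.
  by rewrite divr_gt0 // subr_gt0.
have lae : 0 < la - e.
  have l2 : (0 : R) < ln 2 by rewrite ln_gt0 // ltr1n.
  by rewrite -(pmulr_rgt0 _ be0); lra.
have [c cP] := upper e0.
have /choice[u uP] (k : nat) := cP (Num.truncn (be * k%:R)).+1.
pose F (k : nat) := \big[setU/set0]_(r < 2 ^ k) ball_in X r (u k).
have := @geometric_borel_cantelli _ _ _ P F (expR c) (expR (- (be * (la - e) -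
  ln 2))).
have mF k : measurable (F k) by apply: bigsetU_measurable => r _;
  exact: measurable_ball_in.
set z := expR (- _) => /(_ (expR_ge0 _)) BC.
have {}BC : {ae P, forall w, exists k0, forall k, (k0 <= k)%N -> ~ F k w}.
  apply: BC => // [|k]; first by rewrite expR_gt0 -expR0 ltr_expR oppr_lt0.
  have [_ u0 uk] := uP k.
  apply: le_trans (probability_bigsetU_le _ _ _ _) _; first by move=> r;
    exact: measurable_ball_in.
  under eq_bigr do rewrite probability_ball_in //.
  rewrite sumEFin lee_fin sumr_const card_ord -mulr_natl natrX.
  have -> : (2 : R) ^+ k = expR (k%:R * ln 2) by rewrite expRM_natl lnK ?posrE.
  rewrite -[q _]lnK ?posrE // /z -expRM_natr -!expRD ler_expR.
  apply: le_trans (lerD (lexx _) uk) _.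
  have : (la - e) * (be * k%:R) <= (la - e) * (Num.truncn (be * k%:R)).+1%:R.
    by rewrite ler_pM2l // ltW // truncnS_gt.
  lra.
apply: filterS BC => w [k0 h]; exists k0 => k m k0k mk.
have [un u0 _] := uP k; exists (u k); split => //.
rewrite /nb_balls eq_card0 // => r; rewrite !inE; apply/negP => /eqP hr.
apply: (h k k0k); rewrite /F (bigD1 (Ordinal (leq_trans (ltn_ord r) mk))) //=.
by left.
Qed.

(* If [m >= j 2^k] and a box holds fewer than [j] balls, then one of the first
   [j] blocks of [2^k] consecutive balls misses the box. *)
Lemma ae_not_deficient al : 0 < al -> al * la < ln 2 ->
  {ae P, forall w, exists k0, forall k m, (k0 <= k)%N -> (j * 2 ^ k <= m)%N ->
    ~ deficient_generation p i0 X m j w (Num.truncn (al * k%:R))}.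
Proof.
move=> al0 hal; pose e := (ln 2 / al - la) / 2.
have e0 : 0 < e by rewrite divr_gt0 // subr_gt0 ltr_pdivlMr // mulrC.
(* At generation [n k], a block of [2 ^ k] balls puts on average at least [expR (eta k - c)] of them
   in any given box of positive size. *)
pose eta := ln 2 - al * (la + e).
have eta0 : 0 < eta.
  have -> : eta = (ln 2 - al * la) / 2 by rewrite /eta /e; field;
    rewrite gt_eqF.
  by rewrite divr_gt0 // subr_gt0.
have [c cP] := lower e0.
pose n (k : nat) := Num.truncn (al * k%:R).
have nle k : (n k)%:R <= al * k%:R by rewrite truncn_le // mulr_ge0 // ltW.
pose E k (g : nat) (u : (n k).-tuple 'I_K) :=
  \bigcap_(r in [set` iota (g * 2 ^ k) (2 ^ k)]) ~` ball_in X r u.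
pose F k := \big[setU/set0]_(g < j) \big[setU/set0]_(u :
  (n k).-tuple 'I_K | 0 < q u) E k g u.
have mE k g u : measurable (E k g u).
  apply: fin_bigcap_measurable; first exact: finite_seq.
  by move=> r _; apply: measurableC; exact: measurable_ball_in.
have mF k : measurable (F k).
  by apply: bigsetU_measurable => g _; apply: bigsetU_measurable.
(* There are at most [expR (a k)] words. The bound [x ^+ 2 / 2 <= expR x] at [x = eta k] makes each
   missing event have probability at most [expR (- b k ^+ 2)], which wins over that number. *)
pose a : R := al * ln K%:R; pose b := expR (- c) * (eta ^+ 2 / 2).
have b0 : 0 < b by rewrite mulr_gt0 ?expR_gt0 // divr_gt0 // exprn_gt0.
have a0 : 0 <= a by rewrite mulr_ge0 ?(ltW al0) // ln_ge0 //
  ler1n (leq_ltn_trans _ (ltn_ord i0)).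
pose C := j%:R * expR ((a + 1) ^+ 2 / (4 * b)).
have BC : {ae P, forall w, exists k0, forall k, (k0 <= k)%N -> ~ F k w}.
  apply: (@geometric_borel_cantelli _ _ _ P F C (expR (- 1))) => //.
  - by rewrite mulr_ge0 ?expR_ge0.
  - by rewrite expR_gt0 -expR0 ltr_expR oppr_lt0 /=.
  move=> k; pose y := expR (- (b * k%:R ^+ 2)).
  have Ey g (u : (n k).-tuple 'I_K) : 0 < q u -> (P (E k g u) <= y%:E)%E.
    move=> u0; apply: le_trans (probability_no_ball_le (iota_uniq _ _) u0) _.
    rewrite lee_fin ler_expR lerN2 size_iota natrX.
    have -> : (2 : R) ^+ k = expR (k%:R * ln 2)
      by rewrite expRM_natl lnK ?posrE.
    rewrite -[q u]lnK ?posrE // -expRD.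
    apply: (@le_trans _ _ (expR (- c + eta * k%:R))); last first.
      rewrite ler_expR; have := cP u u0; rewrite size_tuple.
      have : (la + e) * (n k)%:R <= (la + e) * (al * k%:R).
        by rewrite ler_wpM2l // addr_ge0 // ltW.
      rewrite /eta; lra.
    rewrite expRD /b -mulrA ler_wpM2l ?expR_ge0 //.
    have ek : 0 <= eta * k%:R by rewrite mulr_ge0 // ltW.
    have := @expR_ge1Dxn _ (eta * k%:R) 1 ek;
      rewrite (_ : 2`! = 2%N) // exprMn; lra.
  apply: (@le_trans _ _ (\sum_(g < j) \sum_(u : (n k).-tuple 'I_K) y%:E)%E).
    apply: le_trans (probability_bigsetU_le _ _ _ _) _; first by move=> g;
      apply: bigsetU_measurable.
    apply: lee_sum => g _.
    apply: le_trans (probability_bigsetU_le _ _ _ _) _ => //.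
    rewrite [leRHS](bigID (fun u : (n k).-tuple 'I_K => 0 < q u)) /=.
    rewrite -[leLHS]adde0 leeD //; first by apply: lee_sum => u; exact: Ey.
    by apply: sume_ge0 => u _; rewrite lee_fin expR_ge0.
  under eq_bigr do rewrite sumEFin.
  rewrite sumEFin lee_fin !sumr_const card_ord card_tuple card_ord.
  rewrite -[leLHS]mulr_natl -[y *+ _]mulr_natl.
  rewrite /C -[leRHS]mulrA ler_wpM2l // natrX.
  have K0 : (0 : R) < K%:R by rewrite ltr0n (leq_ltn_trans _ (ltn_ord i0)).
  have -> : (K%:R : R) ^+ n k = expR ((n k)%:R * ln K%:R)
    by rewrite expRM_natl lnK ?posrE.
  rewrite /y -expRM_natr -!expRD ler_expR.
  have := @quadratic_le_linear _ a b k%:R b0.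
  have : (n k)%:R * ln K%:R <= al * k%:R * ln K%:R.
    by rewrite ler_wpM2r // ln_ge0 // ler1n (leq_ltn_trans _ (ltn_ord i0)).
  rewrite /a; lra.
apply: filterS BC => w [k0 h]; exists k0 => k m k0k km [u [un u0 uj]].
have {}un : size u == n k by apply/eqP.
move: uj; rewrite ltnNge => /negP; apply; apply: nb_balls_ge km _ => g gj.
apply: contrapT => hg; apply: (h k k0k); rewrite /F (bigD1 (Ordinal gj)) //=;
  left.
rewrite (bigD1 (Tuple un)) //=; left => r /= rg hr; apply: hg; by exists r.
Qed.

(** Compare [m] with the powers of 2 around it. Half of the tolerance goes into [al] and [be]; the
    other half absorbs rounding and bounded shifts of [k]. The bound [de <= la^-1] keeps [al]
    positive and [la^-1 - de] nonnegative. *)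
Lemma ae_first_deficient_dist (de : R) : 0 < de -> de <= la^-1 ->
  {ae P, forall w, exists m0, forall m, (m0 <= m)%N ->
    `|la^-1 - (ln m%:R)^-1 * (first_deficient p i0 X m j w)%:R| <= de}.
Proof.
set v := la^-1 => de0 dev.
have v0 : 0 < v by rewrite invr_gt0.
have t0 : (0 : R) < ln 2 by rewrite ln_gt0 // ltr1n.
set t : R := ln 2 in t0 *.
pose al := t * (v - de / 2); pose be := t * (v + de / 2).
have al0 : 0 < al by rewrite mulr_gt0 //; lra.
have be0 : 0 < be by rewrite mulr_gt0 //; lra.
have vla : v * la = 1 by rewrite /v mulVf // gt_eqF.
have hal : al * la < ln 2.
  rewrite /al -mulrA gtr_pMr // mulrBl vla; have := mulr_gt0 de0 la0; lra.
have hbe : ln 2 < be * la.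
  rewrite /be -mulrA ltr_pMr // mulrDl vla; have := mulr_gt0 de0 la0; lra.
apply: (filterS2 _ _ (ae_not_deficient al0 hal) (ae_deficient be0 hbe)).
move=> w [k1 h1] [k2 h2].
(* The two summands are the thresholds on [k] for [hlo] and [hhi] respectively, extracted below as
   [kx] and [ky]. *)
pose B := Num.truncn (v * (j%:R + 1) / (de / 2) + (be + 1) / (t * (de / 2))).
exists (2 ^ (k1 + k2 + j + B).+1)%N => m mge.
have m1 : (0 < m)%N by apply: leq_trans mge; rewrite expn_gt0.
set k := trunc_log 2 m.
have /andP[km mk] : (2 ^ k <= m < 2 ^ k.+1)%N by exact: trunc_log_bounds.
have kge : ((k1 + k2 + j + B).+1 <= k)%N by exact: trunc_log_max.
have jk : (j <= k)%N by lia.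
have kB : (B.+1 <= k)%N by lia.
(* Shifting [k] down by [j] is enough for the [j] blocks, since [j <= 2 ^ j] gives
   [j * 2 ^ (k - j) <= 2 ^ k <= m]. *)
have nd : ~ deficient_generation p i0 X m j w (Num.truncn (al * (k - j)%:R)).
  apply: h1; first lia.
  apply: leq_trans km; rewrite -{2}(subnKC jk) expnD leq_mul2r.
  by rewrite (ltnW (ltn_expl _ _)) ?orbT.
have dk : deficient_generation p i0 X m j w (Num.truncn (be * k.+1%:R)).+1.
  by apply: h2; [lia|exact: ltnW].
have /andP[Glo Ghi] := first_deficient_bounds nd dk.
set G := first_deficient _ _ _ _ _ _ in Glo Ghi *.
have {}Glo : al * (k%:R - j%:R) <= G%:R.
  apply: (@le_trans _ _ (Num.truncn (al * (k - j)%:R)).+1%:R);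
    last by rewrite ler_nat.
  by rewrite -natrB // ltW // truncnS_gt.
have {}Ghi : G%:R <= be * (k%:R + 1) + 1.
  apply: (@le_trans _ _ (Num.truncn (be * k.+1%:R)).+1%:R);
    first by rewrite ler_nat.
  rewrite -natr1 lerD2r natr1 truncn_le // mulr_ge0 // ltW //.
have Lexp n : ln (2 ^ n)%:R = n%:R * t by rewrite natrX lnXn // mulr_natl.
have mR : (0 : R) < m%:R by rewrite ltr0n.
have p2R n : (0 : R) < (2 ^ n)%:R by rewrite ltr0n expn_gt0.
have Llo : k%:R * t <= ln m%:R by rewrite -Lexp ler_ln ?posrE // ler_nat.
have Lhi : ln m%:R <= (k%:R + 1) * t.
  by rewrite natr1 -Lexp ler_ln ?posrE // ler_nat ltnW.
set L := ln m%:R in Llo Lhi *.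
have kB1 : v * (j%:R + 1) / (de / 2) + (be + 1) / (t * (de / 2)) <= k%:R.
  apply: (@le_trans _ _ B.+1%:R); last by rewrite ler_nat.
  by rewrite ltW // truncnS_gt.
have de20 : 0 < de / 2 by rewrite divr_gt0.
have x0 : 0 <= v * (j%:R + 1) / (de / 2).
  by rewrite divr_ge0 // ?mulr_ge0 ?addr_ge0 // ltW.
have y0 : 0 <= (be + 1) / (t * (de / 2)).
  by apply: divr_ge0; [apply: addr_ge0 => //; exact: ltW | apply: mulr_ge0;
    exact: ltW].
have kx : v * (j%:R + 1) <= k%:R * (de / 2).
  by rewrite -ler_pdivrMr //; lra.
have ky : be + 1 <= k%:R * (t * (de / 2)).
  by rewrite -ler_pdivrMr ?mulr_gt0 //; lra.
have k0 : (0 : R) < k%:R by rewrite ltr0n; exact: leq_trans kB.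
have L0 : 0 < L by apply: lt_le_trans Llo; rewrite mulr_gt0.
have hlo : (v - de) * L <= G%:R.
  apply: (@le_trans _ _ ((v - de) * ((k%:R + 1) * t))).
    by rewrite ler_wpM2l // subr_ge0.
  apply: le_trans Glo; rewrite /al.
  have := ler_wpM2l (ltW t0) kx; have := mulr_gt0 t0 de0.
  have : 0 <= t * j%:R * de by rewrite !mulr_ge0 // ltW.
  lra.
have hhi : G%:R <= (v + de) * L.
  apply: (@le_trans _ _ ((v + de) * (k%:R * t))); last first.
    by rewrite ler_wpM2l // addr_ge0 // ltW.
  apply: le_trans Ghi _; rewrite mulrDr mulr1; move: ky; rewrite /be; lra.
rewrite ler_distlC mulrC ler_pdivlMr // ler_pdivrMr //.
by rewrite hlo hhi.
Qed.

Lemma first_deficient_cvg : {ae P, forall w,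
  (fun m : nat => (ln m%:R)^-1 * (first_deficient p i0 X m j w)%:R) @ \oo -->
    la^-1}.
Proof.
have v0 : 0 < la^-1 by rewrite invr_gt0.
(* Countably many tolerances [la^-1 / N.+1], all at most [la^-1], allow the exceptional null sets to
   be united. *)
have /ae_foralln : forall N :
  nat, {ae P, forall w, exists m0, forall m, (m0 <= m)%N ->
    `|la^-1 - (ln m%:R)^-1 * (first_deficient p i0 X m j w)%:R| <= la^-1 /
      N.+1%:R}.
  move=> N; apply: ae_first_deficient_dist; first by rewrite divr_gt0.
  by rewrite ler_pdivrMr // ler_peMr ?ler1n // ltW.
apply: filterS => w h; apply/cvgrPdist_le => e e0.
have [m0 hm] := h (Num.truncn (la^-1 / e)).
exists m0 => // m /= /hm /le_trans; apply.
by rewrite ler_pdivrMr // -ler_pdivrMl // mulrC ltW // truncnS_gt.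
Qed.


End BallsInBoxes.

Theorem theorem3 (R : realType) (K : nat) (hK : (2 <= K)%N) (p : 'M[R]_K)
  (p_stoch : stochastic p) (p_irr : irreducible_chain p)
  (p_aper : aperiodic_chain p)
  (d : measure_display) (T : measurableType d) (P : probability T R)
  (X : nat -> nat -> T -> 'I_K)
  (hX : balls_process p (Ordinal (ltnW hK)) P X)
  (j : nat) (hj : (1 <= j)%N) :
  cvg (Cstar_ratio p theta @[theta --> -oo]) /\
  {ae P, forall w : T,
    (fun m : nat =>
       (ln m%:R)^-1 * (first_deficient p (Ordinal (ltnW hK)) X m j w)%:R)
      @ \oo --> Cstar p}.
Proof.
have [la [la0 laP sP]] := pressure_slope hK p_stoch p_irr p_aper.
have cv := Cstar_ratio_cvg la0 sP.
have -> : Cstar p = la^-1 by exact: cvg_lim cv.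
split; first exact: cvgP cv.
apply: first_deficient_cvg => //.
- by move=> e; exact: box_size_lower.
- by move=> e; exact: box_size_upper.
Qed.
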